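(* If $\theta_c=0$, then for every $\beta\in[\pi/2,\pi)$ there exists no steady state for $(\beta,\theta_c)$.
   Context: **Steady states.** Fix $\beta\in[\pi/2,\pi)$ and $\theta_c\in[0,\pi]$. A steady state for $(\beta,\theta_c)$ consists of three curves $\Gamma_i=\{(r_i(\alpha),z_i(\alpha)):\alpha\in[0,1]\}$, $i=1,2,3$, with $r_i,z_i\in C^2([0,1])$ (subscript $\alpha$ denotes $d/d\alpha$), such that: (a) $0<r_1,r_3<1$ on $[0,1]$; $0<r_2<1$ on $[0,1)$; $z_1,z_3>0$ on $(0,1]$; $z_2>0$ on $[0,1]$. (b) There are numbers $0<r_1^*<r_3^*<1$, $z_2^*>0$, $\bar r\in(0,1)$, $\bar z>0$ with $(r_1,z_1)(0)=(r_1^*,0)$, $(r_1,z_1)(1)=(\bar r,\bar z)$, $(r_2,z_2)(0)=(\bar r,\bar z)$, $(r_2,z_2)(1)=(1,z_2^* )$, $(r_3,z_3)(0)=(r_3^*,0)$, $(r_3,z_3)(1)=(\bar r,\bar z)$. (c) For each $i$, $r_{i\alpha}^2+z_{i\alpha}^2$ is a positive constant. (d) With $H_i=\frac{r_{i\alpha}z_{i\alpha\alpha}-z_{i\alpha}r_{i\alpha\alpha}}{2(r_{i\alpha}^2+z_{i\alpha}^2)^{3/2}}+\frac{z_{i\alpha}}{2r_i\sqrt{r_{i\alpha}^2+z_{i\alpha}^2}}$, there is $\lambda\in\mathbb R$ with $H_1\equiv H_2\equiv\lambda$ and $H_3\equiv0$ on $[0,1]$. (e) There are continuous $\theta_i:[0,1]\to(-\pi,\pi]$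 with $(\cos\theta_i,\sin\theta_i)=(r_{i\alpha},z_{i\alpha})/\sqrt{r_{i\alpha}^2+z_{i\alpha}^2}$, and $\theta_1(0)=\theta_c$, $\theta_2(1)=0$, $\theta_3(0)=\pi/2$, $-\theta_1(1)+\theta_3(1)=\beta$, $\theta_2(0)-\theta_3(1)=-\pi+\beta$. (f) No $\Gamma_i$ self-intersects, and any two distinct curves $\Gamma_i,\Gamma_j$ intersect only at $(\bar r,\bar z)$. *)

(* Defs.v *)
From Stdlib Require Import Reals.
Open Scope R_scope.

Definition I01 (x : R) : Prop := 0 <= x <= 1.

(* A function in C^2([0,1]) together with its first two derivatives.  [D_in]
   and [continue_in] only look at points of [0,1], so the derivatives at the
   endpoints are one-sided; all values outside [0,1] are irrelevant. *)
Record C2_fun := {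
  val :> R -> R;
  d1 : R -> R;
  d2 : R -> R;
  val_deriv : forall x, I01 x -> D_in val d1 I01 x;
  d1_deriv : forall x, I01 x -> D_in d1 d2 I01 x;
  d2_cont : forall x, I01 x -> continue_in d2 I01 x
}.

Record curve := { r : C2_fun; z : C2_fun }.

Definition point (G : curve) (a : R) : R * R := (r G a, z G a).

Definition speed_sq (G : curve) (a : R) : R :=
  d1 (r G) a ^ 2 + d1 (z G) a ^ 2.

Definition const_speed (G : curve) : Prop :=
  exists c, 0 < c /\ forall a, I01 a -> speed_sq G a = c.

(* Mean curvature of the surface of revolution generated by [G]. *)
Definition mean_curvature (G : curve) (a : R) : R :=
  (d1 (r G) a * d2 (z G) a - d1 (z G) a * d2 (r G) a)
    / (2 * Rpower (speed_sq G a) (3 / 2))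
  + d1 (z G) a / (2 * r G a * sqrt (speed_sq G a)).

(* [th] is a continuous tangent angle along [G] with values in (-PI, PI]; in
   particular the lift may not cross the cut at PI. *)
Definition tangent_angle (G : curve) (th : R -> R) : Prop :=
  forall a, I01 a ->
    continue_in th I01 a /\
    - PI < th a <= PI /\
    cos (th a) = d1 (r G) a / sqrt (speed_sq G a) /\
    sin (th a) = d1 (z G) a / sqrt (speed_sq G a).

Definition simple (G : curve) : Prop :=
  forall a b, I01 a -> I01 b -> point G a = point G b -> a = b.

Definition meet_only_at (G G' : curve) (p : R * R) : Prop :=
  forall a b, I01 a -> I01 b -> point G a = point G' b -> point G a = p.

Record steady_state (beta theta_c : R) := {
  G1 : curve;
  G2 : curve;
  G3 : curve;

  G1_r_range : forall a, 0 <= a <= 1 -> 0 < r G1 a < 1;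
  G2_r_range : forall a, 0 <= a < 1 -> 0 < r G2 a < 1;
  G3_r_range : forall a, 0 <= a <= 1 -> 0 < r G3 a < 1;
  G1_z_pos : forall a, 0 < a <= 1 -> 0 < z G1 a;
  G2_z_pos : forall a, 0 <= a <= 1 -> 0 < z G2 a;
  G3_z_pos : forall a, 0 < a <= 1 -> 0 < z G3 a;

  r1_star : R;
  r3_star : R;
  z2_star : R;
  r_bar : R;
  z_bar : R;
  r_star_order : 0 < r1_star /\ r1_star < r3_star /\ r3_star < 1;
  z2_star_pos : 0 < z2_star;
  r_bar_range : 0 < r_bar < 1;
  z_bar_pos : 0 < z_bar;
  G1_start : point G1 0 = (r1_star, 0);
  G1_end : point G1 1 = (r_bar, z_bar);
  G2_start : point G2 0 = (r_bar, z_bar);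
  G2_end : point G2 1 = (1, z2_star);
  G3_start : point G3 0 = (r3_star, 0);
  G3_end : point G3 1 = (r_bar, z_bar);

  G1_const_speed : const_speed G1;
  G2_const_speed : const_speed G2;
  G3_const_speed : const_speed G3;

  lambda : R;
  G1_curvature : forall a, I01 a -> mean_curvature G1 a = lambda;
  G2_curvature : forall a, I01 a -> mean_curvature G2 a = lambda;
  G3_curvature : forall a, I01 a -> mean_curvature G3 a = 0;

  theta1 : R -> R;
  theta2 : R -> R;
  theta3 : R -> R;
  theta1_angle : tangent_angle G1 theta1;
  theta2_angle : tangent_angle G2 theta2;
  theta3_angle : tangent_angle G3 theta3;
  theta1_start : theta1 0 = theta_c;
  theta2_end : theta2 1 = 0;
  theta3_start : theta3 0 = PI / 2;
  junction_13 : - theta1 1 + theta3 1 = beta;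
  junction_23 : theta2 0 - theta3 1 = - PI + beta;

  G1_simple : simple G1;
  G2_simple : simple G2;
  G3_simple : simple G3;
  G12_meet : meet_only_at G1 G2 (r_bar, z_bar);
  G13_meet : meet_only_at G1 G3 (r_bar, z_bar);
  G23_meet : meet_only_at G2 G3 (r_bar, z_bar)
}.

(* Main.v *)
From Stdlib Require Import Reals Lra.
Require Import Defs.
Open Scope R_scope.

(** Write [c] for the constant squared speed of a curve, [s = sqrt c], and [L]
    for its constant mean curvature.  The two coordinates of the curvature
    equation integrate once:
    - [r z' - L s r^2] is constant along the curve ([radial_flux_constant]);
    - if [L = 0], then [(r r')' = c] ([radial_speed_minimal]).

    The curve [Gamma_3] is minimal and leaves the axis [z = 0] vertically, so
    [r z' = r3* s] and [r r' = c a] along it: it is an arc of a catenary on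
    which [r] has grown strictly, and its final tangent angle [phi] lies in
    [(0, PI/2)] with [r3* < r_bar].  The junction condition then gives
    [Gamma_1] the final angle [phi - beta] in [(- PI, 0)]: it arrives at the
    junction going down.

    If [Gamma_1] starts horizontally ([theta_c = 0]), its first integral reads
    [r z' = lambda s (r^2 - r1*^2)].  At the junction [r = r_bar > r1*] and
    [z' < 0], so [lambda < 0].  But near the start [r > r1*] because
    [r'(0) = s > 0], so the same identity with [lambda < 0] makes [z] decrease
    from [0], against [z > 0]. *)

(** * One-sided calculus on the unit interval *)

Lemma D_in_interior (f d : R -> R) (x : R) :
  0 < x < 1 -> D_in f d I01 x -> derivable_pt_lim f x (d x).
Proof.
  intros Hx Hf eps Heps.
  destruct (Hf eps Heps) as [alp [Halp H]].
  assert (Hd : 0 < Rmin alp (Rmin x (1 - x))) by (repeat apply Rmin_pos; lra).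
  exists (mkposreal _ Hd); intros h Hh Hlt; simpl in Hlt.
  assert (Rabs h < alp) by (eapply Rlt_le_trans; [exact Hlt|apply Rmin_l]).
  assert (Hm : Rabs h < Rmin x (1 - x))
    by (eapply Rlt_le_trans; [exact Hlt|apply Rmin_r]).
  assert (Rabs h < x) by (eapply Rlt_le_trans; [exact Hm|apply Rmin_l]).
  assert (Rabs h < 1 - x) by (eapply Rlt_le_trans; [exact Hm|apply Rmin_r]).
  pose proof (Rle_abs h). pose proof (Rle_abs (- h)) as Hn.
  rewrite Rabs_Ropp in Hn.
  specialize (H (x + h)); simpl in H; unfold Rdist in H.
  replace (x + h - x) with h in H by ring.
  apply H; repeat split; unfold I01; lra.
Qed.

Definition clamp (x : R) : R := Rmax 0 (Rmin 1 x).

Lemma clamp_I01 (x : R) : I01 (clamp x).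
Proof. unfold I01, clamp, Rmax, Rmin; repeat destruct Rle_dec; lra. Qed.

Lemma clamp_id (x : R) : I01 x -> clamp x = x.
Proof. unfold I01, clamp, Rmax, Rmin; repeat destruct Rle_dec; lra. Qed.

Lemma clamp_lipschitz (x y : R) : Rabs (clamp x - clamp y) <= Rabs (x - y).
Proof.
  unfold clamp, Rmax, Rmin; repeat destruct Rle_dec;
    unfold Rabs; repeat destruct Rcase_abs; lra.
Qed.

Lemma continuity_clamp (f : R -> R) (x : R) :
  I01 x -> continue_in f I01 x -> continuity_pt (fun t => f (clamp t)) x.
Proof.
  intros Hx Hf eps Heps.
  destruct (Hf eps Heps) as [alp [Halp H]].
  exists alp; split; [exact Halp|].
  intros y [_ Hy]; simpl in *; unfold Rdist in *.
  rewrite (clamp_id x Hx).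
  destruct (Req_dec x (clamp y)) as [E|E].
  - rewrite <- E, Rminus_diag, Rabs_R0; exact Heps.
  - apply H; repeat split; try apply clamp_I01; auto.
    rewrite <- (clamp_id x Hx) at 1.
    eapply Rle_lt_trans; [apply clamp_lipschitz|exact Hy].
Qed.

(** At [0] and [1] only one-sided behaviour of [f] is known, while [MVT] asks
    for two-sided continuity there; precomposing with [clamp] provides it
    without changing [f] on the unit interval. *)
Lemma mean_value_I01 (f d : R -> R) (a b : R) :
  (forall x, I01 x -> D_in f d I01 x) -> 0 <= a -> a < b -> b <= 1 ->
  exists x, a < x < b /\ f b - f a = d x * (b - a).
Proof.
  intros Hf Ha Hab Hb.
  set (g := fun t => f (clamp t)).
  assert (Hg : forall x, a < x < b -> derivable_pt_lim g x (d x)).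
  { intros x Hx. apply D_in_interior; [lra|].
    intros eps Heps.
    destruct (Hf x ltac:(unfold I01; lra) eps Heps) as [alp [Halp H]].
    exists alp; split; [exact Halp|]; intros y [[Hy Hyx] Hd]; simpl in *.
    unfold g; rewrite (clamp_id y Hy), (clamp_id x) by (unfold I01; lra).
    apply H; repeat split; auto; apply Hy. }
  destruct (MVT g id a b
              (fun x Hx => exist _ (d x) (Hg x Hx))
              (fun x _ => derivable_pt_id x) Hab) as [x [Hx E]].
  - intros x Hx. apply continuity_clamp; [unfold I01; lra|].
    apply cont_deriv with d, Hf; unfold I01; lra.
  - intros x _. apply derivable_continuous_pt, derivable_pt_id.
  - exists x; split; [exact Hx|].
    rewrite derive_pt_id in E; simpl in E; unfold g, id in E.
    rewrite !clamp_id in E by (unfold I01; lra); lra.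
Qed.

Lemma constant_of_null_derivative (f d : R -> R) (a : R) :
  (forall x, I01 x -> D_in f d I01 x) -> (forall x, 0 < x < 1 -> d x = 0) ->
  I01 a -> f a = f 0.
Proof.
  intros Hf H0 Ha.
  destruct (Req_dec a 0) as [->|Hn]; [reflexivity|unfold I01 in Ha].
  destruct (mean_value_I01 f d 0 a Hf) as [x [Hx E]]; try lra.
  rewrite H0 in E by lra; lra.
Qed.

Lemma null_derivative_of_constant (f d : R -> R) (k x : R) :
  (forall t, I01 t -> f t = k) -> 0 < x < 1 -> D_in f d I01 x -> d x = 0.
Proof.
  intros Hk Hx Hf.
  apply (D_in_interior _ _ _ Hx) in Hf.
  pose (pr := exist _ (d x) Hf : derivable_pt f x).
  change (derive_pt f x pr = 0).
  apply (deriv_constant2 f 0 1); try lra.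
  intros y Hy0 Hy1; rewrite !Hk; unfold I01; lra.
Qed.

Lemma increases_from_start (f d : R -> R) :
  D_in f d I01 0 -> 0 < d 0 ->
  exists b, 0 < b <= 1 /\ forall x, 0 < x < b -> f 0 < f x.
Proof.
  intros Hf Hd.
  destruct (Hf (d 0) Hd) as [alp [Halp H]].
  exists (Rmin alp 1); repeat split; [apply Rmin_pos; lra|apply Rmin_r|].
  intros x [Hx0 Hx].
  assert (x < alp) by (eapply Rlt_le_trans; [exact Hx|apply Rmin_l]).
  assert (x < 1) by (eapply Rlt_le_trans; [exact Hx|apply Rmin_r]).
  specialize (H x); simpl in H; unfold Rdist in H.
  rewrite Rminus_0_r in H.
  assert (Hq : Rabs ((f x - f 0) / x - d 0) < d 0).
  { apply H; repeat split; unfold I01; try lra.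
    rewrite Rabs_right; lra. }
  apply Rabs_def2 in Hq.
  assert (Hp : 0 < (f x - f 0) / x * x) by (apply Rmult_lt_0_compat; lra).
  replace ((f x - f 0) / x * x) with (f x - f 0) in Hp by (field; lra).
  lra.
Qed.

(** * First integrals of the curvature equation *)

Lemma Rpower_three_halves (c : R) : 0 < c -> Rpower c (3 / 2) = c * sqrt c.
Proof.
  intros Hc. replace (3 / 2) with (1 + / 2) by field.
  rewrite Rpower_plus, Rpower_1, Rpower_sqrt; auto.
Qed.

(** Differentiating the constant speed gives [r' r'' + z' z'' = 0], so the
    acceleration is normal to the velocity and the signed curvature
    [k = r' z'' - z' r''] determines it: [c z'' = k r'] and [c r'' = - k z'].
    Substituting turns the single curvature equation into one equation for each
    coordinate. *)
Lemma curvature_components (G : curve) (c L a : R) :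
  0 < c -> (forall t, I01 t -> speed_sq G t = c) -> 0 < a < 1 ->
  0 < r G a -> mean_curvature G a = L ->
  r G a * d2 (z G) a + d1 (r G) a * d1 (z G) a
    = 2 * L * sqrt c * r G a * d1 (r G) a /\
  r G a * d2 (r G) a
    = d1 (z G) a ^ 2 - 2 * L * sqrt c * r G a * d1 (z G) a.
Proof.
  intros Hc Hspeed Ha Hr HL.
  assert (Ia : I01 a) by (unfold I01; lra).
  assert (Horth : d1 (r G) a * d2 (r G) a + d1 (z G) a * d2 (z G) a = 0).
  { pose (q t := d1 (r G) t * d1 (r G) t + d1 (z G) t * d1 (z G) t).
    assert (Hq : forall t, I01 t -> q t = c).
    { intros t It; rewrite <- (Hspeed t It); unfold q, speed_sq; ring. }
    pose proof (null_derivative_of_constant q _ c a Hq Ha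
      (Dadd _ _ _ _ _ _
        (Dmult _ _ _ _ _ _ (d1_deriv (r G) a Ia) (d1_deriv (r G) a Ia))
        (Dmult _ _ _ _ _ _ (d1_deriv (z G) a Ia) (d1_deriv (z G) a Ia)))).
    simpl in *; lra. }
  unfold mean_curvature in HL. rewrite (Hspeed a Ia) in HL.
  rewrite Rpower_three_halves in HL by assumption.
  specialize (Hspeed a Ia); unfold speed_sq in Hspeed.
  pose proof (sqrt_lt_R0 c Hc) as Hs.
  set (s := sqrt c) in *. set (r0 := r G a) in *.
  set (r1 := d1 (r G) a) in *. set (z1 := d1 (z G) a) in *.
  set (r2 := d2 (r G) a) in *. set (z2 := d2 (z G) a) in *.
  clearbody s r0 r1 z1 r2 z2.
  set (k := r1 * z2 - z1 * r2) in *.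
  assert (Hk : k * r0 + c * z1 = 2 * L * c * s * r0)
    by (rewrite <- HL; field; lra).
  assert (Hz2 : c * z2 = r1 * k).
  { unfold k; rewrite <- Hspeed.
    transitivity (r1 * (r1 * z2 - z1 * r2) + z1 * (r1 * r2 + z1 * z2));
      [ring|rewrite Horth; ring]. }
  assert (Hr2 : c * r2 = - z1 * k).
  { unfold k; rewrite <- Hspeed.
    transitivity (- z1 * (r1 * z2 - z1 * r2) + r1 * (r1 * r2 + z1 * z2));
      [ring|rewrite Horth; ring]. }
  split; apply Rmult_eq_reg_l with c; try lra.
  - transitivity (r0 * (c * z2) + c * r1 * z1); [ring|rewrite Hz2].
    transitivity (r1 * (k * r0 + c * z1)); [ring|rewrite Hk; ring].
  - transitivity (r0 * (c * r2)); [ring|rewrite Hr2].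
    transitivity (- z1 * (k * r0 + c * z1) + c * z1 ^ 2);
      [ring|rewrite Hk; ring].
Qed.

(** The [z] component says [(r z')' = (L s r^2)'].  This is the vertical force
    balance of a surface of revolution: surface tension against pressure. *)
Lemma radial_flux_constant (G : curve) (c L a : R) :
  0 < c -> (forall t, I01 t -> speed_sq G t = c) ->
  (forall t, I01 t -> 0 < r G t) ->
  (forall t, I01 t -> mean_curvature G t = L) -> I01 a ->
  r G a * d1 (z G) a - L * sqrt c * (r G a * r G a)
  = r G 0 * d1 (z G) 0 - L * sqrt c * (r G 0 * r G 0).
Proof.
  intros Hc Hspeed Hr HL Ha.
  pose (h x := r G x * d1 (z G) x - L * sqrt c * (r G x * r G x)).
  change (h a = h 0).
  refine (constant_of_null_derivative h _ a (fun x Hx =>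
    Dminus _ _ _ _ _ _
      (Dmult _ _ _ _ _ _ (val_deriv (r G) x Hx) (d1_deriv (z G) x Hx))
      (Dmult_const _ _ _ _ _
        (Dmult _ _ _ _ _ _ (val_deriv (r G) x Hx) (val_deriv (r G) x Hx))))
    _ Ha).
  intros x Hx; simpl.
  assert (Ix : I01 x) by (unfold I01; lra).
  destruct (curvature_components G c L x Hc Hspeed Hx (Hr x Ix) (HL x Ix))
    as [E _]; lra.
Qed.

(** For a minimal surface the [r] component is [r r'' = z'^2], hence
    [(r r')' = r'^2 + z'^2 = c]. *)
Lemma radial_speed_minimal (G : curve) (c a : R) :
  0 < c -> (forall t, I01 t -> speed_sq G t = c) ->
  (forall t, I01 t -> 0 < r G t) ->
  (forall t, I01 t -> mean_curvature G t = 0) -> I01 a ->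
  r G a * d1 (r G) a = r G 0 * d1 (r G) 0 + c * a.
Proof.
  intros Hc Hspeed Hr HL Ha.
  pose (h x := r G x * d1 (r G) x - c * x).
  enough (E : h a = h 0) by (unfold h in E; lra).
  refine (constant_of_null_derivative h _ a (fun x Hx =>
    Dminus _ _ _ _ _ _
      (Dmult _ _ _ _ _ _ (val_deriv (r G) x Hx) (d1_deriv (r G) x Hx))
      (Dmult_const _ _ _ _ _ (Dx _ x)))
    _ Ha).
  intros x Hx; simpl.
  assert (Ix : I01 x) by (unfold I01; lra).
  destruct (curvature_components G c 0 x Hc Hspeed Hx (Hr x Ix) (HL x Ix))
    as [_ E].
  specialize (Hspeed x Ix); unfold speed_sq in Hspeed; lra.
Qed.

(** * Vertical and horizontal starts *)

Lemma velocity_of_angle (G : curve) (th : R -> R) (c a : R) :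
  0 < c -> (forall t, I01 t -> speed_sq G t = c) -> tangent_angle G th ->
  I01 a ->
  d1 (r G) a = sqrt c * cos (th a) /\ d1 (z G) a = sqrt c * sin (th a).
Proof.
  intros Hc Hspeed Hth Ha.
  destruct (Hth a Ha) as (_ & _ & Hcos & Hsin).
  rewrite Hcos, Hsin, (Hspeed a Ha).
  pose proof (sqrt_lt_R0 c Hc).
  split; field; lra.
Qed.

Lemma first_quadrant (x : R) :
  - PI < x <= PI -> 0 < cos x -> 0 < sin x -> 0 < x < PI / 2.
Proof.
  intros Hx Hcos Hsin. pose proof PI_RGT_0. split.
  - destruct (Rle_or_lt x 0); [|assumption].
    pose proof (sin_ge_0 (- x) ltac:(lra) ltac:(lra)) as Hn.
    rewrite sin_neg in Hn; lra.
  - destruct (Rle_or_lt (PI / 2) x) as [Hge|]; [|assumption].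
    pose proof (cos_le_0 x Hge ltac:(lra)); lra.
Qed.

(** The catenary [r = r(0) cosh (z / r(0))], seen only through its end point:
    [r r' = c > 0] there while [r z' = r(0) s], and [z' < s] forces [r] to be
    larger than [r(0)]. *)
Lemma vertical_minimal_end (G : curve) (th : R -> R) :
  const_speed G -> (forall t, I01 t -> 0 < r G t) ->
  (forall t, I01 t -> mean_curvature G t = 0) ->
  tangent_angle G th -> th 0 = PI / 2 ->
  0 < th 1 < PI / 2 /\ r G 0 < r G 1.
Proof.
  intros (c & Hc & Hspeed) Hr HL Hth H0.
  assert (I0 : I01 0) by (unfold I01; lra).
  assert (I1 : I01 1) by (unfold I01; lra).
  pose proof (sqrt_lt_R0 c Hc) as Hs.
  pose proof (sqrt_sqrt c (Rlt_le _ _ Hc)) as Hss.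
  pose proof (Hr 0 I0) as Hr0. pose proof (Hr 1 I1) as Hr1.
  destruct (velocity_of_angle G th c 0 Hc Hspeed Hth I0) as [Vr0 Vz0].
  destruct (velocity_of_angle G th c 1 Hc Hspeed Hth I1) as [Vr1 Vz1].
  rewrite H0, cos_PI2 in Vr0. rewrite H0, sin_PI2 in Vz0.
  pose proof (radial_flux_constant G c 0 1 Hc Hspeed Hr HL I1) as Ez.
  pose proof (radial_speed_minimal G c 1 Hc Hspeed Hr HL I1) as Er.
  rewrite Vz0, Vz1 in Ez. rewrite Vr0, Vr1 in Er.
  assert (Hsin : r G 1 * sin (th 1) = r G 0).
  { apply Rmult_eq_reg_l with (sqrt c); lra. }
  assert (Hcos : r G 1 * cos (th 1) = sqrt c).
  { apply Rmult_eq_reg_l with (sqrt c); lra. }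
  assert (Hsin0 : 0 < sin (th 1)).
  { apply Rmult_lt_reg_l with (r G 1); lra. }
  assert (Hcos0 : 0 < cos (th 1)).
  { apply Rmult_lt_reg_l with (r G 1); lra. }
  destruct (Hth 1 I1) as (_ & Hrange & _).
  pose proof (first_quadrant _ Hrange Hcos0 Hsin0) as Hq.
  split; [exact Hq|].
  assert (Hlt : sin (th 1) < 1).
  { pose proof (sin_increasing_1 (th 1) (PI / 2)) as Hmono.
    rewrite sin_PI2 in Hmono. pose proof PI_RGT_0. apply Hmono; lra. }
  pose proof (Rmult_lt_compat_l _ _ _ Hr1 Hlt). lra.
Qed.

(** The identity [r z' = L s (r^2 - r(0)^2)] ties the sign of [z'] to that of
    [L] wherever [r > r(0)].  A downward end with [r] larger than at the start
    needs [L < 0]; but [r > r(0)] also holds just after the horizontal start, so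
    rising from there needs [L > 0]. *)
Lemma horizontal_start_no_downward_end (G : curve) (th : R -> R) (L : R) :
  const_speed G -> (forall t, I01 t -> 0 < r G t) ->
  (forall t, I01 t -> mean_curvature G t = L) ->
  tangent_angle G th -> th 0 = 0 ->
  (forall t, 0 < t <= 1 -> z G 0 < z G t) ->
  r G 0 < r G 1 -> ~ sin (th 1) < 0.
Proof.
  intros (c & Hc & Hspeed) Hr HL Hth H0 Hz Hr01 Hsin.
  assert (I0 : I01 0) by (unfold I01; lra).
  assert (I1 : I01 1) by (unfold I01; lra).
  pose proof (sqrt_lt_R0 c Hc) as Hs.
  destruct (velocity_of_angle G th c 0 Hc Hspeed Hth I0) as [Vr0 Vz0].
  destruct (velocity_of_angle G th c 1 Hc Hspeed Hth I1) as [_ Vz1].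
  rewrite H0, cos_0 in Vr0. rewrite H0, sin_0 in Vz0.
  assert (Hflux : forall t, I01 t ->
    r G t * d1 (z G) t
    = L * (sqrt c * ((r G t - r G 0) * (r G t + r G 0)))).
  { intros t It.
    pose proof (radial_flux_constant G c L t Hc Hspeed Hr HL It) as E.
    rewrite Vz0 in E; lra. }
  assert (Hfactor : forall t, I01 t -> r G 0 < r G t ->
    0 < sqrt c * ((r G t - r G 0) * (r G t + r G 0))).
  { intros t It Ht. pose proof (Hr 0 I0).
    repeat apply Rmult_lt_0_compat; lra. }
  assert (HLneg : L < 0).
  { pose proof (Hflux 1 I1) as E. rewrite Vz1 in E.
    pose proof (Hfactor 1 I1 Hr01) as Hpos.
    destruct (Rlt_or_le L 0) as [|HL0]; [assumption|exfalso].
    pose proof (Rmult_le_pos _ _ HL0 (Rlt_le _ _ Hpos)) as Hge.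
    rewrite <- E in Hge.
    pose proof (Rmult_lt_0_compat _ _ (Hr 1 I1)
      (Rmult_lt_0_compat _ _ Hs (Ropp_0_gt_lt_contravar _ Hsin))).
    lra. }
  destruct (increases_from_start _ _ (val_deriv (r G) 0 I0)) as (b & Hb & Hinc);
    [lra|].
  destruct (mean_value_I01 (z G) (d1 (z G)) 0 b) as (x & Hx & E); try lra.
  { intros x; apply val_deriv. }
  specialize (Hz b Hb).
  assert (Ix : I01 x) by (unfold I01; lra).
  assert (Hdz : 0 < d1 (z G) x).
  { apply Rmult_lt_reg_r with (b - 0); lra. }
  pose proof (Hflux x Ix) as Ex.
  pose proof (Rmult_lt_0_compat _ _ (Hr x Ix) Hdz) as Hp.
  pose proof (Rmult_lt_0_compat _ _ (Ropp_0_gt_lt_contravar _ HLneg)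
    (Hfactor x Ix (Hinc x Hx))) as Hq.
  lra.
Qed.

Theorem lemma4p8 (theta_c : R) (h_theta_c : theta_c = 0) :
  forall beta : R, PI / 2 <= beta < PI -> ~ inhabited (steady_state beta theta_c).
Proof.
  intros beta Hbeta [S].
  pose proof (G1_start _ _ S) as S1. pose proof (G1_end _ _ S) as E1.
  pose proof (G3_start _ _ S) as S3. pose proof (G3_end _ _ S) as E3.
  injection S1 as Sr1 Sz1. injection E1 as Er1 _.
  injection S3 as Sr3 _. injection E3 as Er3 _.
  destruct (vertical_minimal_end (G3 _ _ S) (theta3 _ _ S)) as [Hphi Hr3].
  - apply G3_const_speed.
  - intros t Ht; apply (G3_r_range _ _ S t Ht).
  - apply G3_curvature.
  - apply theta3_angle.
  - apply theta3_start.
  - apply (horizontal_start_no_downward_end (G1 _ _ S) (theta1 _ _ S)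
      (lambda _ _ S)).
    + apply G1_const_speed.
    + intros t Ht; apply (G1_r_range _ _ S t Ht).
    + apply G1_curvature.
    + apply theta1_angle.
    + rewrite theta1_start; exact h_theta_c.
    + intros t Ht; rewrite Sz1; apply (G1_z_pos _ _ S t Ht).
    + destruct (r_star_order _ _ S) as (_ & Hlt & _); lra.
    + pose proof (junction_13 _ _ S).
      apply sin_lt_0_var; lra.
Qed.
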